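(* Let $\Gamma$ be an infinite group generated by a finite set $X$. The following are equivalent: (1) $\Gamma$ has solvable UB-generic Word Problem with respect to $X$; (2) there exists a computably enumerable UB-generic set $S\subset\mathbb F_X$ with $S\cap\ker\pi=\emptyset$; (3) there exists a computably enumerable sequence $\{\omega_n\}_{n\in\mathbb N}\subset\mathbb F_X$ such that $|\omega_n|_\Gamma>n$ for all $n\in\mathbb N$; (4) there exists a computably enumerable sequence $\{\omega_n\}_{n\in\mathbb N}\subset\mathbb F_X$ such that $|\omega_{n+1}|_\Gamma>|\omega_n|_\Gamma$ for all $n\in\mathbb N$.
   Context: $\mathbb F_X$ is the free group on $X$, $\pi:\mathbb F_X\to\Gamma$ the canonical epimorphism, $|\omega|$ the reduced word length, $B_n=\{\omega\in\mathbb F_X:|\omega|\le n\}$, and for $\omega\in\mathbb F_X$, $|\omega|_\Gamma$ denotes the word length of $\pi(\omega)$ in $\Gamma$ with respect to $X$, i.e. $\min\{|v|:v\in\mathbb F_X,\pi(v)=\pi(\omega)\}$. $S\subset\mathbb F_X$ is UB-generic if $\limsup_{n\to\infty}\max_{\omega\in\mathbb F_X}\frac{|S\cap\omega B_n|}{|B_n|}=1$. $\Gamma$ has solvable Word Problem on $S$ if there is a partial algorithm halting at least on every $\omega\in S$ and, whenever it halts, correctly deciding whether $\pi(\omega)$ is trivial; $\Gamma$ has solvable UB-generic Word Problem with respect to $X$ if this holds for some UB-generic $S\subset\mathbb F_X$. *)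

(* Defs.v *)
From HB Require Import structures.
From mathcomp Require Import all_boot all_order all_algebra.
From mathcomp Require Import all_classical all_reals all_analysis.
From mathcomp Require Import Rstruct.
From Stdlib Require Import Rdefinitions.
Set Implicit Arguments. Unset Strict Implicit. Unset Printing Implicit Defensive.
Import Order.TTheory GRing.Theory Num.Theory.
Local Open Scope ring_scope.

(* Model of computation: partial mu-recursive functions on lists of naturals *)

Inductive code : Type :=
  | CZero
  | CSucc
  | CProj of nat
  | CComp of code & codes
  | CPrim of code & code
  | CMu of code
with codes : Type :=
  | CNil
  | CCons of code & codes.

Fixpoint ev (k : nat) (c : code) (v : seq nat) {struct k} : option nat :=
  match k with
  | 0 => None
  | k'.+1 =>
    match c with
    | CZero => Some 0
    | CSucc => Some (head 0 v).+1
    | CProj i => Some (nth 0 v i)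
    | CComp f gs =>
        let fix evs (cs : codes) : option (seq nat) :=
          match cs with
          | CNil => Some [::]
          | CCons g cs' =>
              match ev k' g v with
              | Some a => omap (cons a) (evs cs')
              | None => None
              end
          end in
        match evs gs with Some w => ev k' f w | None => None end
    | CPrim f g =>
        let w := behead v in
        let fix pr (n : nat) : option nat :=
          match n with
          | 0 => ev k' f w
          | n'.+1 => match pr n' with
                     | Some a => ev k' g (n' :: a :: w)
                     | None => None end
          end in
        pr (head 0 v)
    | CMu f =>
        let fix search (j y : nat) : option nat :=
          match j with
          | 0 => None
          | j'.+1 => match ev k' f (y :: v) with
                     | Some 0 => Some y
                     | Some _ => search j' y.+1
                     | None => None
                     end
          end in
        search k' 0
    end
  end.

Definition halts (c : code) (v : seq nat) (r : nat) : Prop :=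
  exists k, ev k c v = Some r.

(* Free group F_X on a finite set X: reduced words over X x bool             *)
(* (bool = true means the inverse letter).                                   *)

Definition letter (X : finType) := (X * bool)%type.
Definition word (X : finType) := seq (letter X).

Definition inv_pair (X : finType) (a b : letter X) : bool :=
  (a.1 == b.1) && (a.2 != b.2).

Definition reduced (X : finType) (w : word X) : bool :=
  sorted (fun a b => ~~ inv_pair a b) w.

Definition red_step (X : finType) (a : letter X) (s : word X) : word X :=
  match s with
  | b :: s' => if inv_pair a b then s' else a :: s
  | [::] => [:: a]
  end.
Definition freduce (X : finType) (w : word X) : word X := foldr (@red_step X) [::] w.

Definition fmul (X : finType) (u v : word X) : word X := freduce (u ++ v).

Definition words_upto (X : finType) (n : nat) : seq (word X) :=
  flatten [seq [seq tval t | t <- enum {: m.-tuple (letter X)}] | m <- iota 0 n.+1].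
Definition ball (X : finType) (n : nat) : seq (word X) :=
  [seq w <- words_upto X n | reduced w].

Definition subFX (X : finType) (S : set (word X)) : Prop :=
  forall w, S w -> reduced w.

Definition ratio (X : finType) (S : set (word X)) (om : word X) (n : nat) : Rdefinitions.R :=
  (((count (fun w => `[< S w >]) (map (fmul om) (ball X n)))%:R : Rdefinitions.R)
     / (size (ball X n))%:R)%R.

Definition UBgeneric (X : finType) (S : set (word X)) : Prop :=
  subFX S /\
  limn_esup (fun n => ereal_sup [set (ratio S om n)%:E | om in [set om | reduced om]])
    = 1%E.

Record group := Group {
  gcar :> Type;
  gmul : gcar -> gcar -> gcar;
  ginv : gcar -> gcar;
  gone : gcar;
  gmulA : forall x y z, gmul x (gmul y z) = gmul (gmul x y) z;
  gmul1 : forall x, gmul gone x = x;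
  gmulV : forall x, gmul (ginv x) x = gone
}.

Definition gpi (X : finType) (G : group) (gen : X -> G) (w : word X) : G :=
  foldr (fun a g => gmul (if a.2 then ginv (gen a.1) else gen a.1) g) (gone G) w.

Definition generates (X : finType) (G : group) (gen : X -> G) : Prop :=
  forall g : G, exists w : word X, reduced w /\ gpi gen w = g.

Definition infinite_group (G : group) : Prop :=
  ~ exists s : list G, forall g : G, List.In g s.

Definition glen (X : finType) (G : group) (gen : X -> G) (w : word X) : nat :=
  xget 0%N [set n | (exists v, reduced v /\ size v = n /\ gpi gen v = gpi gen w)
                 /\ (forall v, reduced v -> gpi gen v = gpi gen w -> leq n (size v))].

Definition CE (X : finType) (S : set (word X)) : Prop :=
  exists c : code, forall w : word X, reduced w ->
    (S w <-> exists r, halts c [:: pickle w] r).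

Definition CEseq (X : finType) (om : nat -> word X) : Prop :=
  (forall n, reduced (om n)) /\
  exists c : code, forall n, halts c [:: n] (pickle (om n)).

Definition WP_solvable_on (X : finType) (G : group) (gen : X -> G)
    (S : set (word X)) : Prop :=
  exists c : code,
    (forall w, S w -> exists r, halts c [:: pickle w] r) /\
    (forall w r, reduced w -> halts c [:: pickle w] r ->
       (r = 1%N /\ gpi gen w = gone G) \/ (r = 0%N /\ gpi gen w <> gone G)).

Definition UBgeneric_WP (X : finType) (G : group) (gen : X -> G) : Prop :=
  exists S : set (word X), UBgeneric S /\ WP_solvable_on gen S.

(* Main.v *)
(* Idea: [S] is UB-generic iff it contains translates [w B_k] of balls of every
   radius [k]. If every [w B_k] met the complement of [S], then the complement
   would have density at least [1 / |B_k| ^ 2] in every ball of radius at least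
   [k]; the converse is immediate.
   (1) => (2): words on which the algorithm answers "nontrivial" still contain
   arbitrarily large balls, because a ball meeting the kernel near its centre can
   be moved away from it inside a larger ball of [S].
   (2) => (3): dovetail to find [w] such that [w B_k] has been enumerated; as
   [w B_k] misses the kernel, [w] has length more than [k] in the quotient.
   (3) => (4): skip ahead to an index bounding the size of the previous word.
   (4) => (1): let [V_n] be the finite set of words with code at most [n]; their
   sizes are at most [n], so the union of the sets [om (n + 1) V_n] misses the
   kernel. It is enumerable, and contains balls of every radius. *)
Require Import Defs.
From HB Require Import structures.
From mathcomp Require Import all_boot all_order all_algebra.
From mathcomp Require Import all_classical all_reals all_analysis.
From mathcomp Require Import Rstruct.
Set Implicit Arguments. Unset Strict Implicit. Unset Printing Implicit Defensive.
Import Order.TTheory GRing.Theory Num.Theory.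
Local Open Scope nat_scope.

(** * Evaluation of codes *)

(** These three definitions name the local fixpoints of [ev], so that inductions can be stated about
    them; the equations [ev_CompE], [ev_PrimE] and [ev_MuE] hold by conversion. *)
Definition evs k v := fix evs (cs : codes) : option (seq nat) :=
  match cs with
  | CNil => Some [::]
  | CCons g cs' => match ev k g v with
                   | Some a => omap (cons a) (evs cs')
                   | None => None
                   end
  end.

Definition ev_prim k f g w := fix pr (n : nat) : option nat :=
  match n with
  | 0 => ev k f w
  | n'.+1 => match pr n' with
             | Some a => ev k g [:: n', a & w]
             | None => None
             end
  end.

Definition ev_mu k f v := fix search (j y : nat) : option nat :=
  match j with
  | 0 => None
  | j'.+1 => match ev k f (y :: v) with
             | Some 0 => Some y
             | Some _ => search j' y.+1
             | None => None
             end
  end.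

Lemma ev_CompE k f gs v :
  ev k.+1 (CComp f gs) v = if evs k v gs is Some w then ev k f w else None.
Proof. by []. Qed.

Lemma ev_PrimE k f g v :
  ev k.+1 (CPrim f g) v = ev_prim k f g (behead v) (head 0 v).
Proof. by []. Qed.

Lemma ev_MuE k f v : ev k.+1 (CMu f) v = ev_mu k f v k 0.
Proof. by []. Qed.

Lemma evS k c v r : ev k c v = Some r -> ev k.+1 c v = Some r.
Proof.
elim: k c v r => // k IH [||i|f gs|f g|f] v r //.
- have evsS: forall cs w, evs k v cs = Some w -> evs k.+1 v cs = Some w.
    elim=> // g cs IHcs w /=; case E: (ev k g v) => [a|//].
    rewrite -/(ev k.+1 g v) (IH _ _ _ E).
    by case E': (evs k v cs) => [w'|//]; rewrite (IHcs _ E').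
  rewrite !ev_CompE; case E: (evs k v gs) => [w|//].
  by rewrite (evsS _ _ E); apply: IH.
- rewrite !ev_PrimE; elim: (head 0 v) r => [|n IHn] r; first exact: IH.
  rewrite /=; case E: (ev_prim k f g _ n) => [a|//] /IH.
  by rewrite (IHn _ E).
(* Only the two iteration bounds and the starting point are generalized; the fuel given to [f] stays
   fixed. *)
- rewrite !ev_MuE; elim: {2 4}k 0 => // j IHj y.
  rewrite [ev_mu k _ _ _ _]/= [ev_mu k.+1 _ _ _ _]/= -/(ev k.+1 f (y :: v)).
  case E: (ev k f (y :: v)) => [a|//]; rewrite (IH _ _ _ E).
  by case: a {E} => // _ /IHj.
Qed.

Lemma ev_mono k l c v r : k <= l -> ev k c v = Some r -> ev l c v = Some r.
Proof. by move/subnK<-; elim: (l - k) => // d IH /IH; apply: evS. Qed.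

Lemma halts_inj c v r s : halts c v r -> halts c v s -> r = s.
Proof.
move=> [k Hk] [l Hl].
have := ev_mono (leq_maxl k l) Hk.
by rewrite (ev_mono (leq_maxr k l) Hl) => -[].
Qed.

Lemma evs_mono k l v cs w : k <= l -> evs k v cs = Some w -> evs l v cs = Some w.
Proof.
move=> le_kl; elim: cs w => // g cs IH w /=.
case E: (ev k g v) => [a|//]; rewrite (ev_mono le_kl E).
by case E': (evs k v cs) => [w'|//]; rewrite (IH _ E').
Qed.

Lemma halts_Comp f gs v k w r :
  evs k v gs = Some w -> halts f w r -> halts (CComp f gs) v r.
Proof.
move=> Hgs [l Hl]; exists (maxn k l).+1.
rewrite ev_CompE (evs_mono (leq_maxl k l) Hgs).
exact: ev_mono (leq_maxr k l) Hl.
Qed.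

Lemma halts_Comp1P f g v r : halts (CComp f (CCons g CNil)) v r ->
  exists2 a, halts g v a & halts f [:: a] r.
Proof.
move=> [[//|k]]; rewrite ev_CompE /=.
by case E: (ev k g v) => [a|//] /= Hf; exists a; exists k.
Qed.

Lemma ev_mu_mono k l f v j j' y r : k <= l -> j <= j' ->
  ev_mu k f v j y = Some r -> ev_mu l f v j' y = Some r.
Proof.
move=> le_kl; elim: j j' y => // j IH [//|j'] y le_j /=.
case E: (ev k f (y :: v)) => [a|//]; rewrite (ev_mono le_kl E).
by case: a {E} => // _; apply: IH.
Qed.

(** The tests below [r] must converge, since [ev_mu] gives up at the first divergent one. *)
Lemma halts_Mu f v r : halts f (r :: v) 0 ->
  (forall y, y < r -> exists a, halts f (y :: v) a.+1) -> halts (CMu f) v r.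
Proof.
move=> H0 H.
suff [k Hk] : exists k, ev_mu k f v k 0 = Some r by exists k.+1.
have [d eq_d] : exists d, d = r by exists r.
(* The induction is on the distance [d] that separates the current candidate from the zero. *)
suff Hd : forall d y, y + d = r -> exists k, ev_mu k f v k y = Some r.
  exact: (Hd r 0).
move=> {eq_d}{}d; elim: d => [|d IH] y.
  rewrite addn0 => ->; have [k Hk] := H0; exists k.+1.
  by rewrite [ev_mu _ _ _ _ _]/= -/(ev k.+1 f (r :: v)) (evS Hk).
move=> eq_r; have [|k Hk] := IH y.+1; first by rewrite addSnnS.
have [|a [l Hl]] := H y; first by rewrite -eq_r -addSnnS leq_addr.
exists (maxn k l).+1; rewrite [ev_mu _ _ _ _ _]/=.
rewrite -/(ev (maxn k l).+1 f (y :: v)).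
rewrite (ev_mono _ Hl) ?(leq_trans (leq_maxr k l)) //.
by apply: ev_mu_mono Hk; rewrite ?leq_maxl // (leq_trans (leq_maxl k l)).
Qed.

Lemma halts_MuP f v r : halts (CMu f) v r -> halts f (r :: v) 0.
Proof.
move=> [[//|k]]; rewrite ev_MuE; elim: {2}k {1}0 => //= j IH y.
case E: (ev k f (y :: v)) => [[|a]|//]; last exact: IH.
by move=> [<-]; exists k.
Qed.

(** * Computable functions *)

(* Vectors are only required to have the right length, so that [f] may take
   arbitrary values elsewhere. *)
Definition computable m (f : seq nat -> nat) : Prop :=
  exists c, forall v, size v = m -> halts c v (f v).

Lemma computable_ext m f g :
  (forall v, size v = m -> f v = g v) -> computable m f -> computable m g.
Proof. by move=> fg [c Hc]; exists c => v Hv; rewrite -fg //; apply: Hc. Qed.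

Lemma computable_evs m gs : List.Forall (computable m) gs ->
  exists cs, forall v, size v = m ->
    exists k, evs k v cs = Some [seq g v | g <- gs].
Proof.
elim=> [|g {}gs [c Hc] _ [cs Hcs]]; first by exists CNil => v _; exists 0.
exists (CCons c cs) => v Hv; have [k Hk] := Hc v Hv; have [l Hl] := Hcs v Hv.
exists (maxn k l) => /=.
by rewrite (ev_mono (leq_maxl k l) Hk) (evs_mono (leq_maxr k l) Hl).
Qed.

Lemma computable_subst m f gs :
  computable (size gs) f -> List.Forall (computable m) gs ->
  computable m (fun v => f [seq g v | g <- gs]).
Proof.
move=> [c Hc] /computable_evs[cs Hcs]; exists (CComp c cs) => v Hv.
have [k Hk] := Hcs v Hv; apply: halts_Comp Hk _.
by apply: Hc; rewrite size_map.
Qed.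

Lemma computable_nth m i : computable m (nth 0 ^~ i).
Proof. by exists (CProj i) => v _; exists 1. Qed.

Lemma computable_succ m f : computable m f -> computable m (fun v => (f v).+1).
Proof.
move=> Hf; have HS : computable 1 (fun v => (head 0 v).+1).
  by exists CSucc => v _; exists 1.
exact: (computable_subst (gs := [:: f]) HS (List.Forall_cons _ Hf (List.Forall_nil _))).
Qed.

Lemma computable_const m n : computable m (fun=> n).
Proof.
elim: n => [|n]; last exact: computable_succ.
by exists CZero => v _; exists 1.
Qed.

Lemma Forall_nth m i n :
  List.Forall (computable m) [seq nth 0 ^~ j | j <- iota i n].
Proof.
elim: n i => [|n IH] i /=; constructor => //; exact: computable_nth.
Qed.

(** Consecutive projections reproduce a tail of the vector; this is how [computable_subst] passes
    parameters on unchanged. *)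
Lemma map_nth_iota (v : seq nat) i n : size v - i = n ->
  [seq g v | g <- [seq nth 0 ^~ j | j <- iota i n]] = drop i v.
Proof.
move=> <-; rewrite -map_comp.
apply: (@eq_from_nth _ 0) => [|j]; first by rewrite size_map size_iota size_drop.
rewrite size_map size_iota => lt_j.
by rewrite (nth_map 0) ?size_iota // nth_iota // nth_drop.
Qed.

Lemma computable_drop n m f :
  computable m f -> computable (n + m) (fun v => f (drop n v)).
Proof.
move=> Hf; apply: (computable_ext (f := fun v =>
  f [seq g v | g <- [seq nth 0 ^~ j | j <- iota n m]])).
  by move=> v Hv; rewrite map_nth_iota // Hv addKn.
by apply: computable_subst (Forall_nth _ _ _); rewrite size_map size_iota.
Qed.

(** [CPrim] recurses on the first entry of its vector, so [P] takes the bound as an extra first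
    argument, for which [N] is then substituted. *)
Lemma computable_iteri m (N a g : seq nat -> nat) :
  computable m N -> computable m a -> computable m.+2 g ->
  computable m (fun v => iteri (N v) (fun i x => g [:: i, x & v]) (a v)).
Proof.
move=> HN [ca Ha] [cg Hg].
pose P w := iteri (head 0 w) (fun i x => g [:: i, x & behead w]) (a (behead w)).
have HP : computable m.+1 P.
  exists (CPrim ca cg) => -[//|n v] [Hv].
  suff [k Hk] : exists k, ev_prim k ca cg v n =
      Some (iteri n (fun i x => g [:: i, x & v]) (a v)) by exists k.+1.
  elim: n => [|n [k Hk]] /=; first exact: Ha.
  have [|l Hl] := Hg [:: n, iteri n (fun i x => g [:: i, x & v]) (a v) & v].
    by rewrite /= Hv.
  exists (maxn k l).
  have -> : ev_prim (maxn k l) ca cg v n =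
      Some (iteri n (fun i x => g [:: i, x & v]) (a v)); last first.
    exact: ev_mono (leq_maxr k l) Hl.
  elim: n (iteri _ _ _) Hk {Hl} => [|n IH] r /=.
    exact/ev_mono/leq_maxl.
  case E: (ev_prim k ca cg v n) => [b|//]; rewrite (IH _ E).
  exact/ev_mono/leq_maxl.
apply: (computable_ext (f := fun v =>
    P [seq h v | h <- N :: [seq nth 0 ^~ j | j <- iota 0 m]])).
  by move=> v Hv; rewrite /P /= map_nth_iota ?subn0 // drop0.
apply: (computable_subst (f := P)); first by rewrite /= size_map size_iota.
by constructor=> //; apply: Forall_nth.
Qed.

Lemma computable_mu m f h : computable m.+1 f ->
  (forall v, size v = m -> f (h v :: v) = 0 /\ forall y, y < h v -> f (y :: v) != 0) ->
  computable m h.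
Proof.
move=> [c Hc] H; exists (CMu c) => v Hv; have [H0 Hlt] := H v Hv.
apply: halts_Mu => [|y /Hlt]; first by rewrite -H0; apply: Hc; rewrite /= Hv.
case E: (f (y :: v)) => [//|a] _; exists a.
by rewrite -E; apply: Hc; rewrite /= Hv.
Qed.

Definition computable1 (h : nat -> nat) := computable 1 (fun v => h (nth 0 v 0)).
Definition computable2 (h : nat -> nat -> nat) :=
  computable 2 (fun v => h (nth 0 v 0) (nth 0 v 1)).

Lemma computable_app1 h m f :
  computable1 h -> computable m f -> computable m (fun v => h (f v)).
Proof.
move=> Hh Hf.
by apply: (computable_subst (gs := [:: f]) Hh); repeat constructor.
Qed.

Lemma computable_app2 h m f g : computable2 h -> computable m f ->
  computable m g -> computable m (fun v => h (f v) (g v)).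
Proof.
move=> Hh Hf Hg.
by apply: (computable_subst (gs := [:: f; g]) Hh); repeat constructor.
Qed.

(** A conditional is a loop of zero or one round started at [g v]; [drop 2] hides the counter and
    the accumulator from [f]. *)
Lemma computable_if m (P : seq nat -> bool) f g :
  computable m (fun v => P v : nat) -> computable m f -> computable m g ->
  computable m (fun v => if P v then f v else g v).
Proof.
move=> HP Hf Hg.
apply: (computable_ext (f := fun v =>
  iteri (P v) (fun i x => f (drop 2 [:: i, x & v])) (g v))).
  by move=> v _; case: (P v); rewrite /= ?drop0.
exact: (computable_iteri HP Hg (computable_drop 2 Hf)).
Qed.

(** * Arithmetic, Boolean tests and finite tables *)

Lemma computable_pred : computable1 predn.
Proof.
apply: (computable_ext (f := fun v =>
  iteri (nth 0 v 0) (fun i _ => i) 0)).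
  by move=> v _; case: (nth 0 v 0).
apply: (computable_iteri (g := nth 0 ^~ 0)); try exact: computable_nth.
exact: computable_const.
Qed.

Lemma iteri_iter n (f : nat -> nat) x : iteri n (fun=> f) x = iter n f x.
Proof. by elim: n => //= n ->. Qed.

Lemma computable_iter m N f a : computable1 f -> computable m N ->
  computable m a -> computable m (fun v => iter (N v) f (a v)).
Proof.
move=> Hf HN Ha; apply: (computable_ext (f := fun v =>
  iteri (N v) (fun i x => f (nth 0 [:: i, x & v] 1)) (a v))).
  by move=> v _; rewrite -iteri_iter.
apply: (computable_iteri (g := fun w => f (nth 0 w 1))) => //.
exact: computable_app1 (computable_nth _ _).
Qed.

Lemma computable_sub : computable2 subn.
Proof.
apply: (computable_ext (f := fun v => iter (nth 0 v 1) predn (nth 0 v 0))).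
  by move=> v _; elim: (nth 0 v 1) => [|n /= ->]; rewrite ?subn0 ?subnS.
apply: computable_iter; try exact: computable_nth.
exact: computable_pred.
Qed.

Lemma computable_add : computable2 addn.
Proof.
apply: (computable_ext (f := fun v => iter (nth 0 v 1) succn (nth 0 v 0))).
  by move=> v _; rewrite iter_succn.
apply: computable_iter; try exact: computable_nth.
exact/computable_succ/computable_nth.
Qed.

Lemma computable_eq0 m f : computable m f -> computable m (fun v => f v == 0 : nat).
Proof.
move=> Hf; apply: (computable_ext (f := fun v => 1 - f v)).
  by move=> v _; case: (f v) => [|n] //; rewrite subSS sub0n.
apply: computable_app2 => //; [exact: computable_sub | exact: computable_const].
Qed.

Lemma computable_neg m (P : seq nat -> bool) :
  computable m (fun v => P v : nat) -> computable m (fun v => ~~ P v : nat).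
Proof.
move=> /computable_eq0; apply: computable_ext => v _.
by case: (P v).
Qed.

Lemma computable_leq m f g : computable m f -> computable m g ->
  computable m (fun v => f v <= g v : nat).
Proof.
by move=> Hf Hg; apply/computable_eq0/computable_app2 => //; apply: computable_sub.
Qed.

Lemma computable_and m (P Q : seq nat -> bool) :
  computable m (fun v => P v : nat) -> computable m (fun v => Q v : nat) ->
  computable m (fun v => P v && Q v : nat).
Proof.
move=> HP HQ; apply: (computable_ext (f := fun v => if P v then Q v : nat else 0)).
  by move=> v _; case: (P v).
by apply: computable_if => //; apply: computable_const.
Qed.

Lemma computable_eqn m f g : computable m f -> computable m g ->
  computable m (fun v => f v == g v : nat).
Proof.
move=> Hf Hg; apply: (computable_ext (f := fun v => (f v <= g v) && (g v <= f v) : nat)).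
  by move=> v _; rewrite -eqn_leq.
by apply: computable_and; apply: computable_leq.
Qed.

Lemma computable_expn2 : computable1 (expn 2).
Proof.
apply: (computable_ext (f := fun v => iter (nth 0 v 0) double 1)).
  by move=> v _; elim: (nth 0 v 0) => // n /= ->; rewrite -mul2n expnS.
apply: computable_iter; [|exact: computable_nth|exact: computable_const].
apply: (computable_ext (f := fun v => nth 0 v 0 + nth 0 v 0)).
  by move=> v _; rewrite addnn.
apply: computable_app2; try exact: computable_nth; exact: computable_add.
Qed.

Lemma computable_mul : computable2 muln.
Proof.
apply: (computable_ext (f := fun v =>
  iteri (nth 0 v 1) (fun i x => nth 0 [:: i, x & v] 1 + nth 0 [:: i, x & v] 2) 0)).
  by move=> v _; elim: (nth 0 v 1) => [|n /= ->]; rewrite ?muln0 ?mulnS // addnC.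
apply: (computable_iteri (g := fun w => nth 0 w 1 + nth 0 w 2)).
- exact: computable_nth.
- exact: computable_const.
- by apply: computable_app2; try exact: computable_nth; exact: computable_add.
Qed.

Lemma computable_odd : computable1 (fun n => odd n : nat).
Proof.
apply: (computable_ext (f := fun v => iter (nth 0 v 0) (fun x => x == 0 : nat) 0)).
  by move=> v _; elim: (nth 0 v 0) => //= n ->; case: (odd n).
apply: computable_iter; [|exact: computable_nth|exact: computable_const].
exact/computable_eq0/computable_nth.
Qed.

Lemma computable_half : computable1 half.
Proof.
apply: (computable_ext (f := fun v =>
  iteri (nth 0 v 0) (fun i x => odd (nth 0 [:: i, x & v] 0) + nth 0 [:: i, x & v] 1) 0)).
  by move=> v _; elim: (nth 0 v 0) => //= n ->; rewrite uphalf_half.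
apply: (computable_iteri (g := fun w => odd (nth 0 w 0) + nth 0 w 1)).
- exact: computable_nth.
- exact: computable_const.
- apply: computable_app2; [exact: computable_add| |exact: computable_nth].
  exact: (computable_app1 computable_odd (computable_nth _ _)).
Qed.

(** The values below [M] are hard-coded one at a time, by a case split at 0 and a shift. This serves
    for functions on a finite alphabet. *)
Lemma computable1_table (t : nat -> nat) M d :
  (forall n, M <= n -> t n = d) -> computable1 t.
Proof.
elim: M t => [|M IH] t Ht.
  apply: (computable_ext (f := fun=> d)); last exact: computable_const.
  by move=> v _; rewrite Ht.
apply: (computable_ext (f := fun v =>
  if nth 0 v 0 == 0 then t 0 else t (nth 0 v 0).-1.+1)).
  by move=> v _; case: (nth 0 v 0).
apply: computable_if; [exact/computable_eq0/computable_nth|exact: computable_const|].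
apply: (computable_app1 (h := fun n => t n.+1)).
  by apply: IH => n le_Mn; apply: Ht.
exact: (computable_app1 computable_pred (computable_nth _ _)).
Qed.

(** * Coded sequences *)

Definition hd s := head 0 (CodeSeq.decode s).
Definition tl s := CodeSeq.code (behead (CodeSeq.decode s)).

Lemma hd_code x l : hd (CodeSeq.code (x :: l)) = x.
Proof. by rewrite /hd CodeSeq.codeK. Qed.

Lemma tl_code l : tl (CodeSeq.code l) = CodeSeq.code (behead l).
Proof. by rewrite /tl CodeSeq.codeK. Qed.

Lemma code_cons x l : CodeSeq.code (x :: l) = 2 ^ x * (CodeSeq.code l).*2.+1.
Proof. by []. Qed.

Lemma code_eq0 l : (CodeSeq.code l == 0) = nilp l.
Proof. by case: l => //= x l; rewrite muln_eq0 expn_eq0. Qed.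

Local Arguments CodeSeq.code : simpl never.

Lemma iter_half i x n : i <= x -> iter i half (2 ^ x * n) = 2 ^ (x - i) * n.
Proof.
elim: i => [|i IH] lt_ix; first by rewrite subn0.
rewrite iterS IH ?(ltnW lt_ix) // -(subnSK lt_ix) expnS -mulnA mul2n.
by rewrite doubleK.
Qed.

(** By [code_cons] the head is the 2-adic valuation of a nonzero code: the least number of halvings
    that leads to an odd number. Code 0 is treated apart, as the search would not end on it. *)
Lemma computable_hd : computable1 hd.
Proof.
apply: (@computable_mu 1 (fun w =>
  if nth 0 w 1 == 0 then 0 else (odd (iter (nth 0 w 0) half (nth 0 w 1)) : nat) == 0)
  (fun v => hd (nth 0 v 0))).
  apply: computable_if; [exact/computable_eq0/computable_nth|exact: computable_const|].
  apply/computable_eq0/(computable_app1 computable_odd).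
  apply: computable_iter; try exact: computable_nth; exact: computable_half.
move=> [//|s [|//]] _; rewrite [nth _ _ _]/= /hd -(CodeSeq.decodeK s).
case: (CodeSeq.decode s) => [|x l] //.
have x0 : (CodeSeq.code (x :: l) == 0) = false by rewrite code_eq0.
rewrite CodeSeq.codeK.
split=> [|y lt_yx]; rewrite ![nth _ _ _]/= x0.
  by rewrite code_cons iter_half // subnn mul1n /= odd_double.
rewrite code_cons iter_half ?(ltnW lt_yx) //.
by rewrite -(subnSK lt_yx) expnS -mulnA oddM.
Qed.

(** Once the power of 2 is divided out, the odd number [2 t + 1] remains, where [t] codes the
    tail. *)
Lemma computable_tl : computable1 tl.
Proof.
apply: (computable_ext (f := fun v =>
  half (iter (hd (nth 0 v 0)) half (nth 0 v 0)))); last first.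
  apply: (computable_app1 computable_half).
  apply: computable_iter; [exact: computable_half| |exact: computable_nth].
  exact: (computable_app1 computable_hd (computable_nth _ _)).
move=> v _; rewrite -(CodeSeq.decodeK (nth 0 v 0)).
case: (CodeSeq.decode _) => [|x l] //.
rewrite hd_code tl_code code_cons iter_half // subnn mul1n.
by rewrite -[_.+1]/(true + _) half_bit_double.
Qed.

Definition cns x s := 2 ^ x * s.*2.+1.

Lemma computable_cns : computable2 cns.
Proof.
apply: (computable_app2 computable_mul).
  exact: (computable_app1 computable_expn2 (computable_nth _ _)).
apply/computable_succ/(computable_ext (f := fun v => nth 0 v 1 + nth 0 v 1)).
  by move=> v _; rewrite addnn.
apply: computable_app2; try exact: computable_nth; exact: computable_add.
Qed.

(** A code thus bounds the number of rounds needed to traverse its list. *)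
Lemma size_code l : size l <= CodeSeq.code l.
Proof.
elim: l => // x l IH; rewrite code_cons; apply: leq_trans (leq_pmull _ _).
  by rewrite /= ltnS (leq_trans IH) // -addnn leq_addr.
by rewrite expn_gt0.
Qed.

Lemma computable_foldl step : computable2 step ->
  computable2 (fun s p => foldl step s (CodeSeq.decode p)).
Proof.
move=> Hstep.
(* Round [i] reads the head of the [i]-th tail and does nothing once the list is exhausted, so
   running too many rounds is harmless. *)
have foldlE l s n : iteri n (fun i a => let r := iter i tl (CodeSeq.code l) in
    if r == 0 then a else step a (hd r)) s = foldl step s (take n l).
  have tlE i : iter i tl (CodeSeq.code l) = CodeSeq.code (drop i l).
    by elim: i => [|i IH]; rewrite ?drop0 // iterS IH tl_code -drop1 drop_drop.
  elim: n => [|n /= ->]; first by rewrite take0.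
  rewrite tlE code_eq0; case: (ltnP n (size l)) => [lt_nl|le_ln].
    rewrite (take_nth 0 lt_nl) foldl_rcons (drop_nth 0 lt_nl) hd_code.
    by [].
  rewrite drop_oversize // !take_oversize //; exact: leq_trans le_ln _.
pose r w := iter (nth 0 w 0) tl (nth 0 w 3).
apply: (computable_ext (f := fun v => iteri (nth 0 v 1) (fun i x =>
   (fun w => if r w == 0 then nth 0 w 1 else step (nth 0 w 1) (hd (r w)))
     [:: i, x & v]) (nth 0 v 0))).
  move=> [//|s [//|p [|//]]] _.
  have := foldlE (CodeSeq.decode p) s p.
  rewrite CodeSeq.decodeK take_oversize => [<- //|].
  by rewrite -{2}(CodeSeq.decodeK p) size_code.
have Hr : computable 4 r.
  apply: computable_iter; try exact: computable_nth; exact: computable_tl.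
apply: (computable_iteri (g := fun w =>
  if r w == 0 then nth 0 w 1 else step (nth 0 w 1) (hd (r w))));
  try exact: computable_nth.
apply: computable_if; [exact: computable_eq0|exact: computable_nth|].
apply: (computable_app2 Hstep); first exact: computable_nth.
exact: computable_app1 computable_hd Hr.
Qed.

(** * A step-bounded interpreter *)

Scheme code_mut := Induction for Defs.code Sort Prop
with codes_mut := Induction for Defs.codes Sort Prop.

Definition enc (o : option nat) := oapp S 0 o.

(* The first coordinate of [w] is the fuel. *)
Definition interp c (w : seq nat) := enc (ev (head 0 w) c (behead w)).

Fixpoint interps (cs : codes) : seq (seq nat -> nat) :=
  if cs is CCons c cs' then interp c :: interps cs' else [::].

Lemma evs_interps k v cs :
  evs k v cs = if all (fun s => s (k :: v) != 0) (interps cs)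
               then Some [seq (s (k :: v)).-1 | s <- interps cs] else None.
Proof.
elim: cs => //= c cs ->; rewrite ![interp _ _]/interp /=.
by case: (ev k c v) => //= a; case: ifP.
Qed.

Lemma computable_all m gs : List.Forall (computable m) gs ->
  computable m (fun v => all (fun g => g v != 0) gs : nat).
Proof.
elim=> [|g {}gs Hg _ IH]; first exact: computable_const.
by apply: computable_and => //; apply/computable_neg/computable_eq0.
Qed.

(** At fuel 0 the value is 0; at positive fuel the hypothesis is applied to the predecessor. *)
Lemma computable_fuel m c :
  computable m.+1 (fun w => enc (ev (head 0 w).+1 c (behead w))) ->
  computable m.+1 (interp c).
Proof.
set F := (F in computable _ F) => HF.
apply: (computable_ext (f := fun w => if nth 0 w 0 == 0 then 0 else
   F [seq g w | g <- (fun w => (nth 0 w 0).-1) :: [seq nth 0 ^~ j | j <- iota 1 m]])).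
  move=> [//|k v] [Hv]; rewrite /interp map_cons map_nth_iota /= ?subn1 // drop0.
  by case: k.
apply: computable_if; [exact/computable_eq0/computable_nth|exact: computable_const|].
apply: (computable_subst (f := F)); first by rewrite /= size_map size_iota.
constructor; last exact: Forall_nth.
exact: computable_app1 computable_pred (computable_nth _ _).
Qed.

Lemma iteri_foldl n (h : nat -> nat -> nat) a :
  iteri n h a = foldl (fun x i => h i x) a (iota 0 n).
Proof.
by elim: n => // n IH; rewrite [LHS]/= IH -[in RHS]addn1 iotaD foldl_cat.
Qed.

(** Bounding the fuel makes evaluation total. The code is fixed and the fuel is an input, so the
    induction is on the code; [m] varies because subprograms take vectors of other lengths. *)
Lemma computable_interp c m : computable m.+1 (interp c).
Proof.
move: c m.
apply: (code_mut (P0 := fun cs => forall m, List.Forall (computable m.+1) (interps cs))).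
- by move=> m; apply/computable_fuel/(computable_const _ 1).
- move=> m; apply/computable_fuel/(computable_ext (f := fun w => (nth 0 w 1).+2)).
    by move=> [//|k [|a v]].
  by do 2!apply/computable_succ; apply: computable_nth.
- move=> i m; apply/computable_fuel/(computable_ext (f := fun w => (nth 0 w i.+1).+1)).
    by move=> [].
  exact/computable_succ/computable_nth.
- move=> f IHf gs IHgs m; apply: computable_fuel.
  pose hs : seq (seq nat -> nat) := nth 0 ^~ 0 :: [seq (fun w => (s w).-1) | s <- interps gs].
  apply: (computable_ext (f := fun w => if all (fun s => s w != 0) (interps gs)
    then interp f [seq h w | h <- hs] else 0)).
    move=> [//|k v] _; rewrite ev_CompE evs_interps [behead _]/= [head _ _]/=.
    by case: ifP => // _; rewrite /interp /= -map_comp.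
  apply: computable_if; [exact: computable_all|apply: computable_subst|exact: computable_const].
    by rewrite /=; apply: IHf.
  constructor; first exact: computable_nth.
  elim: (IHgs m) => [|s ss Hs _ IH]; constructor=> //.
  exact: computable_app1 computable_pred Hs.
- move=> f IHf g IHg m; apply: computable_fuel.
  (* With [w] the fuel followed by the input, the vector [[:: i, x & w]] holds the counter, the
     encoded accumulator, the fuel and the recursion argument in positions 0 to 3. The parameters
     therefore start at 4 there, and at 2 in [w]. *)
  pose fs : seq (seq nat -> nat) := nth 0 ^~ 0 :: [seq nth 0 ^~ j | j <- iota 2 m.-1].
  pose gs : seq (seq nat -> nat) := [:: nth 0 ^~ 2, nth 0 ^~ 0, (fun w => (nth 0 w 1).-1) &
    [seq nth 0 ^~ j | j <- iota 4 m.-1]].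
  pose G u := if nth 0 u 1 == 0 then 0 else interp g [seq h u | h <- gs].
  apply: (computable_ext (f := fun w =>
    iteri (nth 0 w 1) (fun i x => G [:: i, x & w]) (interp f [seq h w | h <- fs]))).
    move=> [//|k v] [Hv]; rewrite ev_PrimE [head 0 (k :: v)]/= [behead (k :: v)]/=.
    have -> : nth 0 (k :: v) 1 = head 0 v by case: (v).
    have Ev : drop 2 (k :: v) = behead v by rewrite /= drop1.
    have szv : size (k :: v) - 2 = m.-1 by rewrite /= Hv subSS subn1.
    elim: (head 0 v) => [|n IH] /=.
      by rewrite map_nth_iota // Ev.
    rewrite IH; case: (ev_prim k f g _ n) => [a|//].
    rewrite /G /= map_nth_iota; last by rewrite -szv /= !subSS.
    by rewrite /interp /= drop1.
  apply: computable_iteri; first exact: computable_nth.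
    apply: computable_subst; first by rewrite /= size_map size_iota; apply: IHf.
    by constructor; [exact: computable_nth|exact: Forall_nth].
  apply: computable_if; [exact/computable_eq0/computable_nth|exact: computable_const|].
  apply: computable_subst; first by rewrite /= size_map size_iota; apply: IHg.
  constructor; first exact: computable_nth.
  constructor; first exact: computable_nth.
  constructor; last exact: Forall_nth.
  exact: computable_app1 computable_pred (computable_nth _ _).
- move=> f IHf m; apply: computable_fuel.
  pose fs : seq (seq nat -> nat) := [:: nth 0 ^~ 2, nth 0 ^~ 0 &
    [seq nth 0 ^~ j | j <- iota 3 m]].
  pose E u := interp f [seq h u | h <- fs].
  (* The state of the search: 0 while searching, 1 after a divergent test,
     [y + 2] once the zero [y] is found. *)
  pose G u := if nth 0 u 1 == 0 then
      if E u == 0 then 1 else if E u == 1 then (nth 0 u 0).+2 else 0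
    else nth 0 u 1.
  (* The final predecessor sends the states 0 and 1 to 0, the encoding of [None], and [y + 2] to
     [y + 1], the encoding of [Some y]. A nonzero state never changes again. *)
  apply: (computable_ext (f := fun w =>
    (iteri (nth 0 w 0) (fun i x => G [:: i, x & w]) 0).-1)).
    move=> [//|k v] [Hv]; rewrite ev_MuE iteri_foldl [head 0 (k :: v)]/= [behead (k :: v)]/=.
    rewrite [nth 0 _ 0]/=.
    have EE j x : E [:: j, x, k & v] = enc (ev k f (j :: v)).
      by rewrite /E /= map_nth_iota /= ?subSS ?subn0 // drop0.
    suff H n y : (foldl (fun x i => G [:: i, x, k & v]) 0 (iota y n)).-1 =
        enc (ev_mu k f v n y) by exact: H.
    elim: n y => //= n IH y; rewrite {2}/G EE /=.
    case: (ev k f (y :: v)) => [[|a]|] //=.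
    + by elim: (iota _ _).
    + by elim: (iota _ _).
  apply: computable_app1 computable_pred _.
  have HE : computable m.+3 E.
    apply: computable_subst; first by rewrite /= size_map size_iota; apply: IHf.
    constructor; first exact: computable_nth.
    constructor; first exact: computable_nth.
    exact: Forall_nth.
  apply: (computable_iteri (g := G)); [exact: computable_nth|exact: computable_const|].
  apply: computable_if; [exact/computable_eq0/computable_nth| |exact: computable_nth].
  apply: computable_if; [exact: computable_eq0|exact: computable_const|].
  apply: computable_if; [|exact/computable_succ/computable_succ/computable_nth|exact: computable_const].
  exact: computable_eqn (computable_const _ _).
- by move=> m; constructor.
- by move=> g IHg gs IHgs m; constructor.
Qed.

(** * Free groups *)

Section FreeGroup.
Variable X : finType.
Implicit Types (a b : letter X) (u v w s : word X).

Definition inv_letter a : letter X := (a.1, ~~ a.2).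
Definition inv_word w : word X := rev [seq inv_letter a | a <- w].

Lemma inv_letterK : involutive inv_letter.
Proof. by case=> x b; rewrite /inv_letter /= negbK. Qed.

Lemma inv_pairE a b : Defs.inv_pair a b = (b == inv_letter a).
Proof.
case: a b => [x c] [y d]; rewrite /Defs.inv_pair /inv_letter xpair_eqE /= eq_sym.
by case: c d => [] [].
Qed.

Lemma reduced_red_step a s : reduced s -> reduced (red_step a s).
Proof.
case: s => [|b s] //= red_bs; case: ifP => [_|ab]; first exact: path_sorted red_bs.
by rewrite /reduced /= ab.
Qed.

Lemma reduced_foldr s u : reduced s -> reduced (foldr (@red_step X) s u).
Proof. by move=> red_s; elim: u => //= a u; apply: reduced_red_step. Qed.

Lemma reduced_freduce w : reduced (freduce w).
Proof. exact: reduced_foldr. Qed.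

(** On reduced words each letter acts bijectively, and the inverse letter undoes it; folding
    [red_step] is thus an action of the free group on reduced words. *)
Lemma red_stepK a s : reduced s -> red_step a (red_step (inv_letter a) s) = s.
Proof.
case: s => [|b s] /=; first by rewrite inv_pairE eqxx.
rewrite !inv_pairE inv_letterK; case: eqP => [->|_] /=; last by rewrite inv_pairE eqxx.
case: s => [|c s] //=; rewrite /reduced /= => /andP[].
by move/negPf=> ->.
Qed.

Lemma foldr_red_step s a u : reduced s ->
  foldr (@red_step X) s (red_step a u) = red_step a (foldr (@red_step X) s u).
Proof.
move=> red_s; case: u => [|b u] //=; case: ifP => //=; rewrite inv_pairE => /eqP->.
by rewrite red_stepK //; apply: reduced_foldr.
Qed.

(** A word and its reduction act alike, which is the source of associativity for free
    multiplication. *)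
Lemma foldr_freduce s u : reduced s ->
  foldr (@red_step X) s (freduce u) = foldr (@red_step X) s u.
Proof. by move=> red_s; elim: u => //= a u IH; rewrite foldr_red_step // IH. Qed.

Lemma freduce_cat u v : freduce (u ++ v) = foldr (@red_step X) (freduce v) u.
Proof. exact: foldr_cat. Qed.

Lemma freduce_id w : reduced w -> freduce w = w.
Proof.
elim: w => //= a w IH red_aw; rewrite (IH (path_sorted red_aw)).
by case: w {IH} red_aw => [|b w] //=; rewrite /reduced /= => /andP[/negPf->].
Qed.

Lemma freduce_catr u v : freduce (u ++ freduce v) = freduce (u ++ v).
Proof. by rewrite !freduce_cat (freduce_id (reduced_freduce v)). Qed.

Lemma freduce_catl u v : freduce (freduce u ++ v) = freduce (u ++ v).
Proof. by rewrite !freduce_cat foldr_freduce // reduced_freduce. Qed.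

Lemma inv_wordK : involutive inv_word.
Proof.
move=> w; rewrite /inv_word map_rev revK -map_comp map_id_in // => a _ /=.
exact: inv_letterK.
Qed.

Lemma size_inv_word w : size (inv_word w) = size w.
Proof. by rewrite size_rev size_map. Qed.

Lemma foldr_inv_word s w : reduced s ->
  foldr (@red_step X) (foldr (@red_step X) s (inv_word w)) w = s.
Proof.
elim: w s => //= a w IH s red_s.
rewrite /inv_word map_cons rev_cons -cats1 foldr_cat /= -/(inv_word w).
by rewrite IH ?red_stepK //; apply: reduced_red_step.
Qed.

Lemma freduce_inv_word w v : freduce (w ++ inv_word w ++ v) = freduce v.
Proof.
by rewrite freduce_cat freduce_cat foldr_inv_word // reduced_freduce.
Qed.

Lemma size_freduce w : size (freduce w) <= size w.
Proof.
elim: w => //= a w IH; case: (freduce w) IH => //= b s IH.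
by case: ifP => _; rewrite ?ltnS //; exact: leqW (ltnW IH).
Qed.

(** * Word length in a quotient *)

Variables (G : group) (gen : X -> G).
Local Notation pi := (gpi gen).
Local Notation "x ** y" := (gmul x y) (at level 40, left associativity).
Local Notation one := (gone G).

Lemma gmulKV (x y : G) : ginv x ** (x ** y) = y.
Proof. by rewrite gmulA gmulV gmul1. Qed.

Lemma gmul_inj (x : G) : injective (gmul x).
Proof. by move=> y z eq_xyz; rewrite -(gmulKV x y) eq_xyz gmulKV. Qed.

Lemma gmulg1 (x : G) : x ** one = x.
Proof. by apply: (@gmul_inj (ginv x)); rewrite gmulKV gmulV. Qed.

Lemma gmulgV (x : G) : x ** ginv x = one.
Proof. by apply: (@gmul_inj (ginv x)); rewrite gmulKV gmulg1. Qed.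

Lemma gmulK (x y : G) : x ** (ginv x ** y) = y.
Proof. by rewrite gmulA gmulgV gmul1. Qed.

Lemma gpi_cat u v : pi (u ++ v) = pi u ** pi v.
Proof. by elim: u => [|a u IH] /=; rewrite ?gmul1 // IH gmulA. Qed.

Lemma gpi_red_step a s : pi (red_step a s) = pi (a :: s).
Proof.
case: s => [|b s] //=; rewrite inv_pairE; case: eqP => // -> /=.
by case: a => x [] /=; rewrite ?gmulK ?gmulKV.
Qed.

Lemma gpi_freduce w : pi (freduce w) = pi w.
Proof. by elim: w => //= a w IH; rewrite gpi_red_step /= IH. Qed.

Lemma gpi_inv_word w : pi w ** pi (inv_word w) = one.
Proof.
have := gpi_freduce (w ++ inv_word w ++ [::]).
by rewrite freduce_inv_word cats0 gpi_cat.
Qed.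

(** Reduction does not lengthen a word, so the minimum over reduced representatives is also the
    minimum over all of them. The value of [xget] is identified by uniqueness of that minimum. *)
Lemma ltn_glen n w : n < glen gen w <-> forall v, pi v = pi w -> n < size v.
Proof.
pose P n := `[< exists v, [/\ reduced v, size v = n & pi v = pi w] >].
have exP : exists n, P n.
  exists (size (freduce w)); apply/asboolP; exists (freduce w).
  by split=> //; [exact: reduced_freduce|exact: gpi_freduce].
case: (ex_minnP exP) => d /asboolP[v [red_v szv piv]] min_d.
have min_size u : pi u = pi w -> d <= size u.
  move=> piu; apply: leq_trans (size_freduce u); apply/min_d/asboolP.
  by exists (freduce u); rewrite gpi_freduce; split=> //; exact: reduced_freduce.
have -> : glen gen w = d.
  apply: xget_unique => [|m [[u [red_u [<- piu]]] min_m]].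
    by split; [exists v|move=> u _; apply: min_size].
  by apply/eqP; rewrite eqn_leq min_size // -szv min_m.
split=> [lt_nd u /min_size|H]; first exact: leq_trans.
by rewrite -szv; apply: H.
Qed.

Lemma glen_size w : glen gen w <= size w.
Proof.
rewrite leqNgt; apply/negP => /ltn_glen/(_ w erefl).
by rewrite ltnn.
Qed.

Lemma mem_words_upto n w : (w \in words_upto X n) = (size w <= n).
Proof.
apply/flattenP/idP => [[s /mapP[m]]|le_wn].
  rewrite mem_iota add0n ltnS => le_mn -> /mapP[t _ ->].
  by rewrite size_tuple.
exists [seq tval t | t <- enum {: (size w).-tuple (letter X)}].
  by apply/mapP; exists (size w); rewrite // mem_iota add0n ltnS.
by apply/mapP; exists (in_tuple w); rewrite ?mem_enum.
Qed.

(** Otherwise the finitely many words of size at most [n] would represent all of [G]. *)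
Lemma exists_long (Hgen : generates gen) (Hinf : infinite_group G) n :
  exists w, n < glen gen w.
Proof.
apply: contrapT => short; apply: Hinf.
exists [seq pi w | w <- words_upto X n] => g.
have [w [_ <-]] := Hgen g.
have [v piv le_vn] : exists2 v, pi v = pi w & size v <= n.
  apply: contrapT => no_v; apply: short; exists w; apply/ltn_glen => v piv.
  by rewrite ltnNge; apply/negP => le_vn; apply: no_v; exists v.
rewrite -piv; have := mem_words_upto n v; rewrite le_vn.
elim: (words_upto X n) => //= u us IH; rewrite inE.
by case: eqP => [<- _|_ /= /IH]; [left|right].
Qed.

End FreeGroup.

(** * Generic sets and balls *)

Section Balls.
Variable X : finType.
Implicit Types (u v w : word X) (S : set (word X)).
Local Notation ball := (Defs.ball X).

(** Arbitrary words [w] and [u] give the same notion as reduced ones, because reducing a word does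
    not lengthen it. *)
Definition contains_balls S :=
  forall k, exists w, forall u, size u <= k -> S (freduce (w ++ u)).

Lemma mem_ball n w : (w \in ball n) = reduced w && (size w <= n).
Proof. by rewrite mem_filter mem_words_upto. Qed.

Lemma uniq_words_upto n : uniq (words_upto X n).
Proof.
rewrite /words_upto; elim: (iota 0 n.+1) (iota_uniq 0 n.+1) => //= m s IH /andP[ms us].
rewrite cat_uniq IH // andbT map_inj_uniq ?enum_uniq /=; last exact: val_inj.
apply/hasPn => w /flattenP[t /mapP[d ds ->] /mapP[x _ ->]].
apply/mapP => -[y _ /(congr1 size)]; rewrite !size_tuple => dm.
by rewrite -dm ds in ms.
Qed.

Lemma uniq_ball n : uniq (ball n).
Proof. exact/filter_uniq/uniq_words_upto. Qed.

(** Each word of the large ball is cut after [n - k] letters. *)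
Lemma size_ball_le n k : k <= n ->
  size (ball n) <= size (ball (n - k)) * size (words_upto X k).
Proof.
move=> le_kn; rewrite -(size_allpairs (fun x u => freduce (x ++ u))).
apply: uniq_leq_size (uniq_ball n) _ => w; rewrite mem_ball => /andP[red_w le_wn].
apply/allpairsP; exists (take (n - k) w, drop (n - k) w); split=> /=.
- rewrite mem_ball size_take_min geq_minl andbT.
  by move: red_w; rewrite /reduced -{1}(cat_take_drop (n - k) w) => /cat_sorted2[].
- by rewrite mem_words_upto size_drop leq_subLR subnK.
- by rewrite cat_take_drop freduce_id.
Qed.

(** Each [v] in the small ball is the product of [v u], whose translate by [om] lies outside [S],
    and the inverse of [u]; so products of such pairs cover the small ball. *)
Lemma size_ball_bad S om n k : k <= n ->
  (forall v, exists2 u, size u <= k & ~ S (freduce (om ++ v ++ u))) ->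
  size (ball (n - k)) <=
    count (fun w => ~~ `[< S (fmul om w) >]) (ball n) * size (words_upto X k).
Proof.
move=> le_kn bad; rewrite -size_filter -(size_allpairs (fun x u => freduce (x ++ u))).
apply: uniq_leq_size (uniq_ball _) _ => v; rewrite mem_ball => /andP[red_v le_v].
have [u le_uk Su] := bad v.
apply/allpairsP; exists (freduce (v ++ u), inv_word u); split=> /=.
- rewrite mem_filter mem_ball reduced_freduce /fmul freduce_catr /=.
  rewrite (leq_trans (size_freduce _)) ?size_cat; last first.
    by rewrite -[leqRHS](subnK le_kn) leq_add.
  by rewrite andbT; apply/asboolPn.
- by rewrite mem_words_upto size_inv_word.
- rewrite freduce_catl -catA -[in RHS](freduce_id red_v) freduce_cat.
  have := freduce_inv_word u [::]; rewrite cats0 => ->.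
  by rewrite /= (freduce_id red_v) -/(freduce v) freduce_id.
Qed.

Lemma size_ball_gt0 n : 0 < size (ball n).
Proof. by rewrite lt0n size_eq0; apply/eqP => b0; have := mem_ball n [::]; rewrite b0. Qed.

Lemma ratioE S om n :
  Defs.ratio S om n = ((count (fun w => `[< S (fmul om w) >]) (ball n))%:R
                  / (size (ball n))%:R)%R.
Proof. by rewrite /Defs.ratio count_map. Qed.

Lemma ratio_le1 S om n : (Defs.ratio S om n <= 1)%R.
Proof.
rewrite ratioE ler_pdivrMr ?ltr0n ?size_ball_gt0 // mul1r ler_nat.
exact: count_size.
Qed.

(** The two counting bounds combine into a bound of the ball by [K ^ 2] times its number of bad
    points; [K] counts all words of size at most [k], reduced or not. *)
Lemma ratio_le S om n k : k <= n ->
  (forall v, exists2 u, size u <= k & ~ S (freduce (om ++ v ++ u))) ->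
  (Defs.ratio S om n <= 1 - ((size (words_upto X k) ^ 2)%:R)^-1)%R.
Proof.
move=> le_kn bad; set K := size _.
have K_gt0 : 0 < K.
  by rewrite lt0n size_eq0; apply/eqP => b0; have := mem_words_upto k ([::] : word X); rewrite b0.
have N_gt0 := size_ball_gt0 n.
have le_bad : size (ball n) <=
    count (fun w => ~~ `[< S (fmul om w) >]) (ball n) * (K ^ 2).
  apply: leq_trans (size_ball_le le_kn) _.
  by rewrite expnS expn1 mulnA leq_mul2r size_ball_bad ?orbT.
rewrite ratioE ler_pdivrMr ?ltr0n // mulrBl mul1r lerBrDr.
rewrite -[leRHS]/((size _)%:R)%R -(count_predC (fun w => `[< S (fmul om w) >]) (ball n)).
rewrite natrD lerD2l mulrC ler_pdivrMr ?ltr0n ?expn_gt0 ?K_gt0 //.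
by rewrite -natrD -natrM ler_nat count_predC.
Qed.

Lemma UBgenericP S : subFX S -> UBgeneric S <-> contains_balls S.
Proof.
move=> subS; split=> [[_ lim1] k|ballS].
  apply: contrapT => no_ball.
  have bad om v : exists2 u, size u <= k & ~ S (freduce (om ++ v ++ u)).
    apply: contrapT => no_u; apply: no_ball; exists (om ++ v) => u le_uk.
    by rewrite -catA; apply: contrapT => Su; apply: no_u; exists u.
  have c_lt1 : (1 - ((size (words_upto X k) ^ 2)%:R)^-1 < 1 :> Rdefinitions.R)%R.
    rewrite ltrBlDr ltrDl invr_gt0 ltr0n expn_gt0 lt0n size_eq0.
    by rewrite orbF; apply/eqP => b0; have := mem_words_upto k ([::] : word X); rewrite b0.
  move: c_lt1; rewrite -lte_fin; apply/negP; rewrite -leNgt -lim1.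
  (* The limit superior is an infimum over neighbourhoods of infinity; the tail [k <= n] gives the
     bound. *)
  apply: (@le_trans _ _ (ereal_sup
    ((fun n => ereal_sup [set (Defs.ratio S om n)%:E | om in [set om | reduced om]])
       @` [set n | k <= n]%classic))).
    apply: ereal_inf_lbound; exists [set n | k <= n]%classic => //.
    by exists k.
  apply: ge_ereal_sup => _ [n /= le_kn <-].
  by apply: ge_ereal_sup => _ [om _ <-]; rewrite lee_fin ratio_le.
split=> //.
(* For every [n] some translate of the ball lies inside [S], so each supremum is already 1. *)
have -> : (fun n => ereal_sup [set (Defs.ratio S om n)%:E | om in [set om | reduced om]])
          = cst (1 : \bar Rdefinitions.R)%E.
  apply/funext => n; apply/eqP; rewrite eq_le; apply/andP; split.
    by apply: ge_ereal_sup => _ [om _ <-]; rewrite lee_fin ratio_le1.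
  apply: ereal_sup_ubound; have [w ballw] := ballS n.
  exists (freduce w); first exact: reduced_freduce.
  rewrite ratioE; have /eqP -> : count (fun u => `[< S (fmul (freduce w) u) >]) (ball n)
    == size (ball n).
    rewrite -all_count; apply/allP => u; rewrite mem_ball => /andP[_ le_un].
    by apply/asboolP; rewrite /fmul freduce_catl; apply: ballw.
  by rewrite divff // pnatr_eq0 -lt0n size_ball_gt0.
by rewrite is_cvg_limn_esupE; [exact: lim_cst|exact: is_cvg_cst].
Qed.

End Balls.

(** * The free group action on coded words *)

Section CodedWords.
Variables (X : finType) (a0 : letter X).
Implicit Types (u v w s : word X) (g : letter X -> letter X).

Lemma pickle_wordE w : pickle w = CodeSeq.code [seq pickle a | a <- w].
Proof. by []. Qed.

(** Decoding is made total: a number that codes no letter is read as [a0], so every number yields a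
    word. *)
Definition letter_of n : letter X := odflt a0 (pickle_inv n).
Definition word_of p : word X := [seq letter_of n | n <- CodeSeq.decode p].

Lemma word_of_pickle w : word_of (pickle w) = w.
Proof.
rewrite /word_of pickle_wordE CodeSeq.codeK -map_comp map_id_in // => a _ /=.
by rewrite /letter_of pickleK_inv.
Qed.

Lemma size_word_of p : size (word_of p) <= p.
Proof. by rewrite size_map -{2}(CodeSeq.decodeK p) size_code. Qed.

Lemma size_pickle w : size w <= pickle w.
Proof. by rewrite pickle_wordE -(size_map (@pickle (letter X))) size_code. Qed.

Definition letter_bound := \max_(a : letter X) pickle a.

(** Beyond [letter_bound] no number codes a letter, so the function is constant there. *)
Lemma computable_letter g : computable1 (fun n => pickle (g (letter_of n))).
Proof.
apply: (@computable1_table _ letter_bound.+1 (pickle (g a0))) => n lt_n.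
rewrite /letter_of; case E: (pickle_inv n) => [a|//].
have := pickle_invK n (T := letter X); rewrite E /= => an.
by have := leq_bigmax (F := @pickle (letter X)) a; rewrite an leqNgt lt_n.
Qed.

Definition red_code g (p n : nat) : nat :=
  if (p != 0) && (hd p == pickle (inv_letter (g (letter_of n)))) then tl p
  else cns (pickle (g (letter_of n))) p.

Lemma red_codeE g s n :
  red_code g (pickle s) n = pickle (red_step (g (letter_of n)) s).
Proof.
rewrite /red_code !pickle_wordE code_eq0; case: s => [|b s] //=.
rewrite hd_code inv_pairE (inj_eq (pcan_inj pickleK)) tl_code.
by case: eqP.
Qed.

Lemma computable_red_code g : computable2 (red_code g).
Proof.
apply: computable_if.
- apply: computable_and; first exact/computable_neg/computable_eq0/computable_nth.
  apply: computable_eqn; first exact: computable_app1 computable_hd (computable_nth _ _).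
  apply: (computable_app1 (h := fun n => pickle (inv_letter (g (letter_of n)))));
    last exact: computable_nth.
  exact: (computable_letter (fun a => inv_letter (g a))).
- exact: computable_app1 computable_tl (computable_nth _ _).
- apply: (computable_app2 computable_cns); last exact: computable_nth.
  apply: (computable_app1 (h := fun n => pickle (g (letter_of n))));
    last exact: computable_nth.
  exact: computable_letter.
Qed.

(** A left fold lets the first letter act first, so the word coded by [p] acts reversed. With [g]
    the inversion of letters this is the action of the inverse word; with [g] the identity, that of
    the reversed word. *)
Definition act_code g (q p : nat) := foldl (red_code g) q (CodeSeq.decode p).

Lemma act_codeE g s p : act_code g (pickle s) p =
  pickle (foldr (@red_step X) s (rev [seq g a | a <- word_of p])).
Proof.
rewrite /act_code /word_of; elim: (CodeSeq.decode p) s => //= n l IH s.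
by rewrite red_codeE IH rev_cons -cats1 foldr_cat.
Qed.

Lemma computable_act_code g : computable2 (act_code g).
Proof. exact/computable_foldl/computable_red_code. Qed.

(** Coding is monotone in each letter and in the tail, so this strictly bounds the codes of words of
    size at most [k]. A loop over numbers can then exhaust a ball. *)
Definition code_bound k := iter k (fun b => (cns letter_bound b).+1) 1.

Lemma computable_code_bound : computable1 code_bound.
Proof.
apply: computable_iter; [|exact: computable_nth|exact: computable_const].
apply/computable_succ/(computable_app2 computable_cns); last exact: computable_nth.
exact: computable_const.
Qed.

Lemma ltn_code_bound k w : size w <= k -> pickle w < code_bound k.
Proof.
elim: k w => [|k IH] [|a w] // lt_wk.
rewrite pickle_wordE map_cons code_cons -pickle_wordE [code_bound _]/= ltnS /cns.
apply: leq_mul; first by rewrite leq_exp2l // (leq_bigmax (F := @pickle (letter X))).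
by rewrite ltnS leq_double ltnW ?IH.
Qed.

End CodedWords.

(** This supplies the default letter that total decoding requires. *)
Lemma exists_letter (X : finType) (G : group) (gen : X -> G) :
  generates gen -> infinite_group G -> inhabited (letter X).
Proof.
move=> Hgen Hinf; have [[|a w]] := exists_long Hgen Hinf 0; last by split.
by move/(leq_ltn_trans (leq0n 0))/leq_trans/(_ (glen_size _ _)).
Qed.

Lemma halts_search (f : seq nat -> nat) c v :
  (forall y, halts c (y :: v) (f (y :: v))) ->
  (exists y, f (y :: v) = 0) <-> exists r, halts (CMu c) v r.
Proof.
move=> Hc; split=> [[y fy0]|[r /halts_MuP Hr]]; last first.
  by exists r; apply: halts_inj (Hc r) Hr.
have ex0 : exists y, f (y :: v) == 0 by exists y; rewrite fy0.
case: (ex_minnP ex0) => r /eqP fr0 min_r; exists r.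
apply: halts_Mu => [|z lt_zr]; first by rewrite -fr0.
case E: (f (z :: v)) (Hc z) => [|b] Hz; last by exists b.
by have := min_r z; rewrite E leqNgt lt_zr => /(_ isT).
Qed.

(** * The implications between the four conditions *)

Section Equivalences.
Variables (X : finType) (G : group) (gen : X -> G).
Hypotheses (Hgen : generates gen) (Hinf : infinite_group G).
Implicit Types (S : set (word X)) (u w : word X).
Local Notation pi := (gpi gen).
Local Notation trivial w := (pi w = gone G).

(* If [w u] lies in the kernel with [u] of length at most [k], then [g] of
   length more than [k] in the quotient moves [w u] to the centre [w u g] of a
   ball of radius [k] that avoids the kernel. *)
Lemma contains_balls_nontrivial S : contains_balls S ->
  contains_balls (fun w => S w /\ ~ trivial w).
Proof.
move=> ballS k; have [g /ltn_glen lt_kg] := exists_long Hgen Hinf k.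
(* The radius leaves room for [u], then [g], then a word of size at most [k]. *)
have [w ballw] := ballS (k + (size g + k)).
case: (pselect (exists2 u, size u <= k & trivial (w ++ u))) => [[u le_uk wu1]|no_u].
  exists (w ++ u ++ g) => v le_vk; split.
    by rewrite -!catA; apply: ballw; rewrite !size_cat !leq_add.
  rewrite gpi_freduce catA gpi_cat gpi_cat wu1 gmul1 => gv1.
  have := lt_kg (inv_word v); rewrite size_inv_word ltnNge le_vk => H.
  suff /H : pi (inv_word v) = pi g by [].
  by rewrite -[LHS]gmul1 -gv1 -gmulA gpi_inv_word gmulg1.
exists w => u le_uk; split.
  by apply: ballw; rewrite (leq_trans le_uk) // leq_addr.
by rewrite gpi_freduce => wu1; apply: no_u; exists u.
Qed.

Lemma CE_of_WP : UBgeneric_WP gen ->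
  exists S, CE S /\ UBgeneric S /\ forall w, S w -> ~ trivial w.
Proof.
move=> [S [genS [c [haltS decS]]]]; have subS := proj1 genS.
pose S0 w := reduced w /\ halts c [:: pickle w] 0.
have S0_nontriv w : S0 w -> ~ trivial w.
  by move=> [red_w /(decS _ _ red_w)[[//]|[]]].
exists S0; split; last split=> //.
  (* The search variable comes first, so [CProj 1] reads the input. The test is the same in every
     round: the search stops at once if [c] answers 0, and otherwise never. *)
  exists (CMu (CComp c (CCons (CProj 1) CNil))) => w red_w; split=> [[_ cw]|[r Hr]].
    exists 0; apply: halts_Mu => //; case: cw => k ck; apply: (@halts_Comp _ _ _ 1) => //.
    by exists k.
  split=> //; case/halts_Comp1P: (halts_MuP Hr) => a Ha.
  by rewrite -(halts_inj (ex_intro _ 1 erefl : halts (CProj 1) [:: r; pickle w] (pickle w)) Ha).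
have /contains_balls_nontrivial ballS := (UBgenericP subS).1 genS.
apply/UBgenericP => [w []//|k]; have [w ballw] := ballS k; exists w => u /ballw[Su nontriv].
have red_u := subS _ Su; split=> //; have [r Hr] := haltS _ Su.
by case: (decS _ _ red_u Hr) => [[]//|[r0 _]]; rewrite r0 in Hr.
Qed.

Definition computable_words (om : nat -> word X) := computable1 (fun n => pickle (om n)).

Lemma CEseqP om : CEseq om <-> (forall n, reduced (om n)) /\ computable_words om.
Proof.
split=> -[red_om [c Hc]]; split=> //; exists c; first by move=> [//|n [|//]] _; apply: Hc.
by move=> n; apply: (Hc [:: n]).
Qed.

Lemma growing_of_long om : CEseq om -> (forall n, n < glen gen (om n)) ->
  exists om, CEseq om /\ forall n, glen gen (om n) < glen gen (om n.+1).
Proof.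
move=> /CEseqP[red_om com] long_om.
(* The code of a word bounds its size, hence its length in the quotient, and so serves as the next
   index. *)
pose om' n := iter n (fun w => om (pickle w)) (om 0).
exists om'; split=> [|n]; last first.
  apply: leq_ltn_trans (long_om (pickle (om' n))).
  exact: leq_trans (glen_size _ _) (size_pickle _).
apply/CEseqP; split=> [[|n]|]; [exact: red_om|exact: red_om|].
apply: (computable_ext (f := fun v =>
  iter (nth 0 v 0) (fun p => pickle (om p)) (pickle (om 0)))).
  by move=> v _; rewrite /om'; elim: (nth 0 v 0) => //= n ->.
by apply: computable_iter => //; [exact: computable_nth|exact: computable_const].
Qed.

(** A strictly increasing sequence of naturals dominates its index; the shift by one makes the
    inequality strict. *)
Lemma long_of_growing om : CEseq om -> (forall n, glen gen (om n) < glen gen (om n.+1)) ->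
  CEseq (om \o succn) /\ forall n, n < glen gen ((om \o succn) n).
Proof.
move=> /CEseqP[red_om com] grow.
have le_glen n : n <= glen gen (om n).
  by elim: n => // n IH; apply: leq_ltn_trans (grow n).
split=> [|n]; last exact: le_glen.
apply/CEseqP; split=> [n|]; first exact: red_om.
apply: (computable_app1 (h := fun n => pickle (om n))) => //.
exact/computable_succ/computable_nth.
Qed.

Lemma WP_of_long om : CEseq om -> (forall n, n < glen gen (om n)) -> UBgeneric_WP gen.
Proof.
move=> /CEseqP[red_om com] long_om; have [a0] := exists_letter Hgen Hinf.
(* This is the union of the translates by [om n] of the words with code at most [n]. Dividing by
   [om n] turns membership into a decidable test for each [n]. *)
pose S w := reduced w /\
  exists n, pickle (foldr (@red_step X) w (inv_word (om n))) <= n.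
have nontriv w : S w -> ~ trivial w.
  move=> [red_w [n]]; set u := foldr _ _ _ => le_un w1.
  have /ltn_glen/(_ (inv_word u)) := long_om n.
  rewrite size_inv_word ltnNge (leq_trans (size_pickle u)) // => H.
  suff /H : pi (inv_word u) = pi (om n) by [].
  have : pi u = gmul (pi (inv_word (om n))) (pi w).
    rewrite -gpi_cat -(gpi_freduce gen (_ ++ _)) freduce_cat (freduce_id red_w).
    by [].
  rewrite w1 gmulg1 => piu.
  have := gpi_inv_word gen u; rewrite piu => /(congr1 (gmul (pi (om n)))).
  by rewrite gmulA gpi_inv_word gmul1 gmulg1.
exists S; split.
  (* At [n = code_bound X k] all reduced words of size at most [k] have code at most [n], so [om n]
     is the centre of a ball of radius [k] in [S]. *)
  apply/UBgenericP => [w []//|k]; pose n := code_bound X k.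
  exists (om n) => u le_uk; split; first exact: reduced_freduce.
  exists n; rewrite freduce_cat -{1}(inv_wordK (om n)) foldr_inv_word ?reduced_freduce //.
  by apply/ltnW/ltn_code_bound; rewrite (leq_trans (size_freduce u)).
pose f v := ~~ (act_code a0 (@inv_letter X) (nth 0 v 1) (pickle (om (nth 0 v 0))) <= nth 0 v 0) : nat.
have [c Hc] : computable 2 f.
  apply/computable_neg/computable_leq; last exact: computable_nth.
  apply: (computable_app2 (computable_act_code _ _)); first exact: computable_nth.
  apply: (computable_app1 (h := fun n => pickle (om n))) => //.
  exact: computable_nth.
have fS w : reduced w -> S w <-> exists n, f [:: n; pickle w] = 0.
  move=> red_w; have fE n : (f [:: n; pickle w] == 0) =
      (pickle (foldr (@red_step X) w (inv_word (om n))) <= n).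
    by rewrite /f /= act_codeE word_of_pickle; case: (_ <= n).
  split=> [[_ [n]]|[n /eqP]]; rewrite ?fE => le_n; last by split=> //; exists n.
  by exists n; apply/eqP; rewrite fE.
have search w := @halts_search f c [:: pickle w] (fun y => Hc [:: y; pickle w] erefl).
(* The only answer ever given is 0, for nontrivial; composition is strict, so it is given only when
   the search ends. *)
exists (CComp CZero (CCons (CMu c) CNil)); split=> [w Sw|w r red_w].
  have [r [k Hr]] := (search w).1 ((fS w (proj1 Sw)).1 Sw).
  by exists 0; apply: (@halts_Comp _ _ _ k [:: r]); [rewrite /= Hr|exists 1].
case/halts_Comp1P => a Ha H0; right; split.
  exact: halts_inj H0 (ex_intro _ 1 erefl).
by apply: nontriv; apply/(fS w red_w)/(search w); exists a.
Qed.

Lemma long_of_CE S : CE S -> UBgeneric S -> (forall w, S w -> ~ trivial w) ->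
  exists om, CEseq om /\ forall n, n < glen gen (om n).
Proof.
move=> [c Hc] genS nontriv; have [a0] := exists_letter Hgen Hinf.
have subS := proj1 genS; have ballS := (UBgenericP subS).1 genS.
pose A := act_code a0 id.
have AE s p : A (pickle s) p = pickle (foldr (@red_step X) s (rev (word_of a0 p))).
  by rewrite /A act_codeE map_id.
pose empty := pickle ([::] : word X).
(* [y] codes a fuel followed by the reversal of a word [w]; the test succeeds
   when [c] halts within the fuel on [w u], for [u] the reversal of the word
   coded by [z]. *)
pose T z y := interp c [:: hd y; A (A empty z) (tl y)].
(* A bounded universal quantifier written as a loop, with 0 for success to suit minimization. *)
pose f y k := iteri (code_bound X k) (fun z x => if T z y == 0 then 1 else x) 0.
have f0P y k : f y k == 0 <-> forall z, z < code_bound X k -> T z y != 0.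
  rewrite /f; elim: (code_bound X k) => [|b [IH1 IH2]] //=.
  split; last first.
    by move=> H; rewrite (negPf (H b _)) // IH2 // => z lt_z; apply: H; apply: ltnW.
  case: (T b y =P 0) => // /eqP Tb fb0 z; rewrite ltnS leq_eqVlt => /orP[/eqP->//|].
  exact: IH1 fb0 z.
have cf : computable 2 (fun v => f (nth 0 v 0) (nth 0 v 1)).
  have cT : computable 4 (fun v => T (nth 0 v 0) (nth 0 v 2)).
    have cA g h : computable 4 g -> computable 4 h -> computable 4 (fun v => A (g v) (h v)).
      exact/computable_app2/computable_act_code.
    apply: (computable_subst (gs := [:: (fun v => hd (nth 0 v 2));
      (fun v => A (A empty (nth 0 v 0)) (tl (nth 0 v 2)))]) (computable_interp c 1)).
    constructor; first exact: computable_app1 computable_hd (computable_nth _ _).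
    constructor; last by constructor.
    apply: (cA); last exact: computable_app1 computable_tl (computable_nth _ _).
by apply: (cA); [exact: computable_const|exact: computable_nth].
  apply: (computable_iteri (g := fun v => if T (nth 0 v 0) (nth 0 v 2) == 0 then 1 else nth 0 v 1)).
  - exact: computable_app1 (computable_code_bound X) (computable_nth _ _).
  - exact: computable_const.
  - apply: computable_if; [exact: computable_eq0|exact: computable_const|exact: computable_nth].
have ex_y k : exists y, f y k == 0.
  (* The radius is not [k]: the loop tests every [z] below the bound, and such a [z] may code a word
     longer than [k], though of size at most [z]. *)
  have [w ballw] := ballS (code_bound X k).
  pose x z := pickle (freduce (w ++ rev (word_of a0 z))).
  have halt_x z : z < code_bound X k -> exists t, ev t c [:: x z] != None.
    move=> lt_z; have Sx : S (freduce (w ++ rev (word_of a0 z))).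
      by apply: ballw; rewrite size_rev (leq_trans (size_word_of _ _)) // ltnW.
    by have [r [t Ht]] := (Hc _ (subS _ Sx)).1 Sx; exists t; rewrite Ht.
  (* Finitely many halting computations share a common fuel, the maximum of theirs. *)
  have [t Ht] : exists t, forall z, z < code_bound X k -> ev t c [:: x z] != None.
    elim: (code_bound X k) halt_x => [|b IH] halt_x; first by exists 0.
    have [t1 H1] := halt_x b (ltnSn b).
    have [|t2 H2] := IH; first by move=> z lt_z; apply/halt_x/ltnW.
    exists (maxn t1 t2) => z; rewrite ltnS leq_eqVlt => /orP[/eqP->|/H2].
      by case E: (ev t1 c _) H1 => [r|//] _; rewrite (ev_mono (leq_maxl _ _) E).
    by case E: (ev t2 c _) => [r|//] _; rewrite (ev_mono (leq_maxr _ _) E).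
  exists (cns t (pickle (rev w))); apply/f0P => z /Ht.
  rewrite /T -[cns _ _]/(CodeSeq.code (t :: [seq pickle a | a <- rev w])).
  rewrite hd_code tl_code /= -pickle_wordE !AE word_of_pickle revK.
  rewrite -/(freduce (rev (word_of a0 z))) -freduce_cat -/(x z) /interp /=.
  by case: (ev t c _).
pose y k := ex_minn (ex_y k).
have cy : computable1 y.
  apply: (@computable_mu 1 (fun v => f (nth 0 v 0) (nth 0 v 1))) => // -[//|k [|//]] _ /=.
  rewrite /y; case: ex_minnP => m /eqP fm0 min_m; split=> // z; apply: contraL.
  by rewrite -leqNgt; apply: min_m.
pose om k := freduce (rev (word_of a0 (tl (y k)))).
have omE k : pickle (om k) = A empty (tl (y k)) by rewrite AE.
exists om; split.
  apply/CEseqP; split=> [k|]; first exact: reduced_freduce.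
  apply: (computable_ext (f := fun v => A empty (tl (y (nth 0 v 0))))) => [v _|].
    by rewrite omE.
  apply: (computable_app2 (computable_act_code _ _)); first exact: computable_const.
  exact: computable_app1 computable_tl (computable_app1 cy (computable_nth _ _)).
move=> k; apply/ltn_glen => v piv; rewrite ltnNge; apply/negP => le_vk.
(* A short representative [v] of [om k] would have its inverse among the tested words, placing the
   trivial element [om k] times [u] in [S]. *)
pose u := inv_word v.
have /f0P/(_ (pickle (rev u))) : f (y k) k == 0 by rewrite /y; case: ex_minnP.
have szu : size (rev u) <= k by rewrite size_rev /u size_inv_word.
rewrite ltn_code_bound // => /(_ isT).
rewrite /T AE word_of_pickle revK -/(freduce u) AE -freduce_cat /interp /=.
case E: (ev _ c _) => [r|//] _.
have : S (freduce (rev (word_of a0 (tl (y k))) ++ u)).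
  by apply/(Hc _ (reduced_freduce _)); exists r; exists (hd (y k)).
move/nontriv; apply; rewrite gpi_freduce gpi_cat -(gpi_freduce gen (rev _)) -/(om k) -piv.
exact: gpi_inv_word.
Qed.

End Equivalences.

Theorem theorem4p1 (X : finType) (G : group) (gen : X -> G)
  (Hgen : generates gen) (Hinf : infinite_group G) :
  [<-> UBgeneric_WP gen;
       exists S : set (word X), CE S /\ UBgeneric S /\
         (forall w, S w -> gpi gen w <> gone G);
       exists om : nat -> word X, CEseq om /\ (forall n, (n < glen gen (om n))%N);
       exists om : nat -> word X, CEseq om /\
         (forall n, (glen gen (om n) < glen gen (om n.+1))%N)].
Proof.
tfae.
- exact: CE_of_WP.
- by move=> [S [ceS [genS nontriv]]]; apply: long_of_CE nontriv.
- by move=> [om [ce_om long_om]]; apply: growing_of_long long_om.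
(* The way from (4) to (1) passes through (3), for the shifted sequence. *)
- move=> [om [ce_om grow]]; have [ce_om' long_om] := long_of_growing ce_om grow.
  exact: WP_of_long long_om.
Qed.
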